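(* Let $(X,d)$ be a separable metric space and let $\Omega\subset X$ be non-empty, open and proper (i.e. $\Omega\ne X$). For any $p\ge 1$, the map $$\iota': Wb_p(\Omega)\to(\mathcal M(\Omega^* ),W_p),\qquad \iota'(\mu)=\mu+\infty\cdot[\![\partial]\!],$$ is an isometric embedding, i.e. $W_p(\iota'(\mu),\iota'(\nu))=Wb_p(\mu,\nu)$ for all $\mu,\nu\in Wb_p(\Omega)$.
   Context: Measures are non-negative Borel measures (infinite total mass is allowed), $\mathcal M(Y)$ is the set of Borel measures on $Y$, and $[\![x]\!]$ is the Dirac mass at $x$; $\infty\cdot[\![\partial]\!]$ is the measure assigning $\infty$ to Borel sets containing $\partial$ and $0$ to the others. For a measure $\gamma$ on a product, $\pi_1\gamma$ and $\pi_2\gamma$ are its coordinate projections (push-forwards under $(x,y)\mapsto x$, $(x,y)\mapsto y$). Partial transport: for $\mu,\nu\in\mathcal M(\Omega)$ and $p\in[1,\infty)$, $$Wb_p(\mu,\nu)=\inf_\gamma\Big(\int_{X\times X}d(x,y)^p\,\mathrm d\gamma(x,y)\Big)^{1/p},$$ the infimum being over all $\gamma\in\mathcal M(X\times X)$ with $(\pi_1\gamma)|_\Omega=\mu$ and $(\pi_2\gamma)|_\Omega=\nu$. $Wb_p(\Omega)$ is the set of $\mu\in\mathcal M(\Omega)$ with $Wb_p(\mu,0)<\infty$, equipped with $Wb_p$. Shortcut space: $\Omega^*=\Omega\cup\{\partial\}$, where $\partial$ is an additional point, with the metric $$\delta(x,y)=\min\{d(x,y),\ \operatorname{dist}(x,X\setminus\Omega)+\operatorname{dist}(y,X\setminus\Omega)\}\quad(x,y\in\Omega),\qquad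 \delta(x,\partial)=\operatorname{dist}(x,X\setminus\Omega).$$ Wasserstein distance: for $\alpha,\beta\in\mathcal M(\Omega^* )$, $W_p(\alpha,\beta)=\inf_\gamma(\int_{\Omega^*\times\Omega^*}\delta(x,y)^p\,\mathrm d\gamma(x,y))^{1/p}$, the infimum being over $\gamma\in\mathcal M(\Omega^*\times\Omega^* )$ with $\pi_1\gamma=\alpha$, $\pi_2\gamma=\beta$. *)

(* Defs.v *)
From HB Require Import structures.
From mathcomp Require Import all_boot all_order all_algebra.
From mathcomp Require Import all_classical all_reals all_analysis.
From mathcomp Require Import lra.

Set Implicit Arguments.
Unset Strict Implicit.
Unset Printing Implicit Defensive.

Import Order.TTheory GRing.Theory Num.Theory.
Import numFieldNormedType.Exports.

Local Open Scope classical_set_scope.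
Local Open Scope ring_scope.

Definition separable (T : topologicalType) : Prop :=
  exists2 S : set T, countable S & dense S.

(* [g_sigma_algebraType] carries a measurable structure on pointed types only,
   whence the pointed instances below. *)
Notation borel T := (g_sigma_algebraType (@open T)).

Notation borel_measure R T := {measure set (borel T) -> \bar R}.

Definition borel_fst (S T : ptopologicalType) : borel (S * T)%type -> borel S :=
  fst.

Definition borel_snd (S T : ptopologicalType) : borel (S * T)%type -> borel T :=
  snd.

Arguments borel_fst {S T}.
Arguments borel_snd {S T}.

Record domain (R : realType) (X : metricType R) := Domain {
  domain_set :> set X ;
  domain_open : open domain_set ;
  domain_neq0 : domain_set !=set0 ;
  domain_proper : domain_set != setT }.

Definition domain_point (R : realType) (X : metricType R) (Omega : domain X) :
    set_type Omega :=
  let: exist x xO := cid (domain_neq0 Omega) in SigSub (mem_set xO).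

(* The space X itself, with an element of Omega as distinguished point. *)
Definition ambient (R : realType) (X : metricType R) (Omega : domain X) : Type :=
  X.

Section pointed_carriers.
Context {R : realType} {X : metricType R} (Omega : domain X).

HB.instance Definition _ :=
  isPointed.Build (set_type Omega) (domain_point Omega).

HB.instance Definition _ := Metric.copy (ambient Omega) X.
HB.instance Definition _ :=
  isPointed.Build (ambient Omega) (set_val (domain_point Omega)).

End pointed_carriers.

Definition dist_to (R : realType) (X : metricType R) (A : set X) (x : X) : R :=
  inf [set mdist x y | y in A].

(* [None] is the additional point. *)
Definition shortcut (R : realType) (X : metricType R) (Omega : domain X) :
    Type := option (set_type Omega).

Section shortcut_metric.
Context {R : realType} {X : metricType R} (Omega : domain X).

Local Notation bdist := (dist_to (~` Omega)).

Definition sdist (a b : shortcut Omega) : R :=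
  match a, b with
  | Some x, Some y =>
      Num.min (mdist (set_val x) (set_val y)) (bdist (set_val x) + bdist (set_val y))
  | Some x, None => bdist (set_val x)
  | None, Some y => bdist (set_val y)
  | None, None => 0
  end.

Let image_neq0 (x : X) : [set mdist x y | y in ~` Omega] !=set0.
Proof.
have : ~` Omega !=set0.
  apply/set0P/eqP => CO0; move/eqP: (domain_proper Omega); apply.
  by rewrite -[LHS]setCK CO0 setC0.
by move=> [y Oy]; exists (mdist x y), y.
Qed.

Let lb0 (x : X) : lbound [set mdist x y | y in ~` Omega] 0.
Proof. by move=> _ [y _ <-]; exact: mdist_ge0. Qed.

Lemma bdist_ge0 (x : X) : 0 <= bdist x.
Proof. by apply: lb_le_inf => //; exact: lb0. Qed.

Lemma bdist_triangle (x y : X) : bdist x <= mdist x y + bdist y.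
Proof.
rewrite -lerBlDl; apply: lb_le_inf => // _ [z Oz <-].
rewrite lerBlDl (le_trans _ (metric_triangle _ _ _))//.
by apply: ge_inf; [exists 0; exact: lb0|exists z].
Qed.

Lemma bdist_gt0 (x : X) : (Omega : set X) x -> 0 < bdist x.
Proof.
move=> Ox; have : nbhs x (Omega : set X).
  by apply: open_nbhs_nbhs; split => //; exact: domain_open.
move=> /nbhs_ballP[e /= e0 xeO]; apply: (lt_le_trans e0).
apply: lb_le_inf => // _ [y Oy <-]; rewrite leNgt; apply/negP => xye.
by apply: Oy; apply: xeO; rewrite ballEmdist.
Qed.

Let bdist_val_gt0 (x : set_type Omega) : 0 < bdist (set_val x).
Proof. by apply: bdist_gt0; exact: set_valP. Qed.

Let sdistxx a : sdist a a = 0.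
Proof.
case: a => [x|]//=; rewrite mdistxx; apply/min_idPl.
by rewrite addr_ge0// bdist_ge0.
Qed.

Let sdist_positivity a b : sdist a b = 0 -> a = b.
Proof.
case: a b => [x|] [y|]//=.
- have := bdist_val_gt0 x; have := bdist_val_gt0 y.
  case: (leP (mdist _ _)) => _ y0 x0; last by move=> h; exfalso; lra.
  by rewrite !set_valE => /mdist_positivity/val_inj ->.
- by move=> d0; have := bdist_val_gt0 x; rewrite d0 ltxx.
- by move=> d0; have := bdist_val_gt0 y; rewrite d0 ltxx.
Qed.

Let sdist_sym a b : sdist a b = sdist b a.
Proof. by case: a b => [x|] [y|]//=; rewrite metric_sym addrC. Qed.

Let sdist_triangle b a c : sdist a c <= sdist a b + sdist b c.
Proof.
have H x y : bdist x <= mdist x y + bdist y := bdist_triangle x y.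
case: a b c => [x|] [y|] [z|] //=;
  rewrite ?add0r ?addr0 ?ge_min ?addr_ge0 ?bdist_ge0 ?lexx ?orbT//.
- have := metric_triangle (set_val x) (set_val y) (set_val z).
  have := H (set_val x) (set_val y); have := H (set_val z) (set_val y).
  have := bdist_ge0 (set_val y); rewrite (metric_sym (set_val z)).
  case: (leP (mdist (set_val x) (set_val y))) => _;
    case: (leP (mdist (set_val y) (set_val z))) => _ ????;
    apply/orP; first [left; lra | right; lra].
- have := H (set_val x) (set_val y); have := bdist_ge0 (set_val y).
  by case: (leP (mdist _ _)) => _ ??; lra.
- have := H (set_val z) (set_val y); have := bdist_ge0 (set_val y).
  by rewrite (metric_sym (set_val z)); case: (leP (mdist _ _)) => _ ??; lra.
Qed.

HB.instance Definition _ :=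
  Choice.copy (shortcut Omega) (option (set_type Omega)).
HB.instance Definition _ := isPointed.Build (shortcut Omega) None.
HB.instance Definition _ := isMetric.Build R (shortcut Omega)
  sdistxx sdist_positivity sdist_sym sdist_triangle.

End shortcut_metric.

Section infinite_dirac.
Local Open Scope ereal_scope.
Context {d : measure_display} {T : measurableType d} {R : realType} (a : T).

Definition infinite_dirac (A : set T) : \bar R := +oo * \d_a A.

Lemma infinite_diracE A : infinite_dirac A = if a \in A then +oo else 0.
Proof.
by rewrite /infinite_dirac diracE; case: (a \in A); rewrite ?mule1 ?mule0.
Qed.

Let infinite_dirac0 : infinite_dirac set0 = 0.
Proof. by rewrite /infinite_dirac measure0 mule0. Qed.

Let infinite_dirac_ge0 A : 0 <= infinite_dirac A.
Proof. by rewrite /infinite_dirac mule_ge0. Qed.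

Let infinite_dirac_sigma_additive : semi_sigma_additive infinite_dirac.
Proof.
have E A : infinite_dirac A =
    mseries (fun=> \d_a : {measure set T -> \bar R}) 0 A.
  rewrite /infinite_dirac /mseries/= diracE; have [aA|aA] := boolP (a \in A).
    rewrite mule1; apply/esym/cvg_lim => //.
    under eq_fun do rewrite sumEFin sumr_const_nat subn0.
    exact/cvgeryP/cvgr_idn.
  by rewrite mule0 eseries0.
move=> F mF tF mUF; rewrite E; under eq_fun do under eq_bigr do rewrite E.
exact: measure_semi_sigma_additive.
Qed.

HB.instance Definition _ := isMeasure.Build _ _ _ infinite_dirac
  infinite_dirac0 infinite_dirac_ge0 infinite_dirac_sigma_additive.

End infinite_dirac.

Section iota'.
Local Open Scope ereal_scope.
Context {R : realType} {X : metricType R} {Omega : domain X}.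
Implicit Type mu : borel_measure R (set_type Omega).

Definition shortcut_inj : borel (set_type Omega) -> borel (shortcut Omega) :=
  Some.

Lemma measurable_shortcut_inj : measurable_fun setT shortcut_inj.
Proof.
apply: measurability; first by [].
move=> _ [U oU <-]; rewrite setTI; apply: sub_sigma_algebra.
rewrite openE => x Ux.
have /nbhs_ballP[e /= e0 xeU] : nbhs (Some x : shortcut Omega) U.
  by apply: open_nbhs_nbhs; split.
apply/nbhs_ballP; exists e => //= y xey; apply: xeU.
change (sdist (Some x) (Some y) < e)%R; rewrite /= gt_min; apply/orP; left.
by move: xey; rewrite /ball /= /initial_ball ballEmdist.
Qed.

(* The measure on Omega, seen as a measure on the shortcut space. *)
Definition extend mu : set (borel (shortcut Omega)) -> \bar R :=
  pushforward mu shortcut_inj.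

Let extend0 mu : extend mu set0 = 0.
Proof. by rewrite /extend /pushforward preimage_set0 measure0. Qed.

Let extend_ge0 mu A : 0 <= extend mu A.
Proof. exact: (measure_ge0 mu). Qed.

Let extend_sigma_additive mu : semi_sigma_additive (extend mu).
Proof.
apply: measure_semi_sigma_additive; exact: measurable_shortcut_inj.
Qed.

HB.instance Definition _ mu := isMeasure.Build _ _ _ (extend mu)
  (extend0 mu) (extend_ge0 mu) (@extend_sigma_additive mu).

Definition iota' mu : borel_measure R (shortcut Omega) :=
  measure_add (extend mu) (infinite_dirac (None : borel (shortcut Omega))).

Lemma iota'E mu A :
  iota' mu A = mu (shortcut_inj @^-1` A) +
               infinite_dirac (None : borel (shortcut Omega)) A.
Proof. exact: measure_addE. Qed.

End iota'.

Section transport.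
Local Open Scope ereal_scope.
Context {R : realType} {X : metricType R} {Omega : domain X}.

Local Notation XX := (ambient Omega * ambient Omega)%type.
Local Notation SS := (shortcut Omega * shortcut Omega)%type.

Definition cost (T : metricType R) (p : R) (z : T * T) : \bar R :=
  (mdist z.1 z.2 `^ p)%:E.

(* Borel sets of the open set Omega are Borel in X. *)
Definition restr_domain (m : set (borel (ambient Omega)) -> \bar R) :
    set (borel (set_type Omega)) -> \bar R :=
  fun B => m (set_val @` B).

Definition partial_coupling (mu nu : borel_measure R (set_type Omega))
    (gamma : borel_measure R XX) : Prop :=
  forall B : set (borel (set_type Omega)), measurable B ->
    restr_domain (pushforward gamma borel_fst) B = mu B /\
    restr_domain (pushforward gamma borel_snd) B = nu B.

Definition Wb (p : R) (mu nu : borel_measure R (set_type Omega)) : \bar R :=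
  ereal_inf [set (\int[gamma]_z cost p z) `^ p^-1
            | gamma in partial_coupling mu nu].

Definition Wb_space (p : R) : set (borel_measure R (set_type Omega)) :=
  [set mu | Wb p mu mzero < +oo].

Definition coupling (alpha beta : borel_measure R (shortcut Omega))
    (gamma : borel_measure R SS) : Prop :=
  forall B : set (borel (shortcut Omega)), measurable B ->
    pushforward gamma borel_fst B = alpha B /\ pushforward gamma borel_snd B = beta B.

Definition W (p : R) (alpha beta : borel_measure R (shortcut Omega)) : \bar R :=
  ereal_inf [set (\int[gamma]_z cost p z) `^ p^-1
            | gamma in coupling alpha beta].

End transport.

(* Main.v *)
(* Collapsing X \ Omega to the additional point is 1-Lipschitz, so pushing a
   partial coupling forward and adding infinite mass at (None, None), which is
   free, gives W <= Wb. Conversely fix c > 1. Given a coupling on the shortcut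
   space, the mass at pairs where the direct path is optimal is kept; at any other
   pair (a, b), the mass is split into one part going from a to a point near its
   projection onto X \ Omega (at distance less than c dist(a, X \ Omega)) and one
   part coming to b from such a point, the two costs adding up to at most c^p times
   the original one since s^p + t^p <= (s + t)^p. Separability provides a measurable
   choice of near projections with countably many values. Let c tend to 1. *)
Require Import Defs.
From HB Require Import structures.
From mathcomp Require Import all_boot all_order all_algebra.
From mathcomp Require Import all_classical all_reals all_analysis.
From mathcomp Require Import measurable_realfun.
From mathcomp Require Import lra.

Import Order.TTheory GRing.Theory Num.Theory.
Import numFieldNormedType.Exports.

Local Open Scope classical_set_scope.
Local Open Scope ring_scope.

(* [S * T] is not declared as a [ptopologicalType] in the library, hence the
   formulation with arbitrary families of generators. *)
Lemma generated_measurable_fun d (S : measurableType d) (T : pointedType)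
    (G : set (set T)) (f : S -> T) :
  (forall U, G U -> measurable (f @^-1` U)) ->
  measurable_fun [set: S] (f : S -> g_sigma_algebraType G).
Proof.
move=> mf; apply: measurability; first by [].
by move=> _ [U GU <-]; rewrite setTI; exact: mf.
Qed.

Lemma generated_measurable_fun_real (R : realType) (S : pointedType)
    (G : set (set S)) (f : S -> R) :
  (forall U, open U -> G (f @^-1` U)) ->
  measurable_fun [set: g_sigma_algebraType G] (f : g_sigma_algebraType G -> R).
Proof.
move=> Gf; apply: (measurability _ (RGenOpens.measurableE R)).
move=> _ [_ [a [b ->]] <-]; rewrite setTI.
by apply: sub_sigma_algebra; apply: Gf; exact: interval_open.
Qed.

(** * Continuity of pairs and of the distance, dense sequences *)

Lemma continuous_at_pair (Z S T : topologicalType) (f : Z -> S) (g : Z -> T) z :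
  {for z, continuous f} -> {for z, continuous g} ->
  {for z, continuous (fun x => (f x, g x))}.
Proof.
move=> cf cg U [[A B] /= [fA gB] AB].
have zA : nbhs z (f @^-1` A) := cf _ fA.
have zB : nbhs z (g @^-1` B) := cg _ gB.
by apply: (filterS _ (filterI zA zB)) => x [Ax Bx]; exact: AB.
Qed.

Section metric.
Context {R : realType} {T : metricType R}.
Implicit Types x y z : T.

Lemma mdist_lipschitz x y x' y' :
  `|mdist x y - mdist x' y'| <= mdist x x' + mdist y y'.
Proof.
have := metric_triangle x x' y; have := metric_triangle x' y' y.
have := metric_triangle x' x y'; have := metric_triangle x y y'.
rewrite (metric_sym x' x) (metric_sym y' y) ler_norml => *; apply/andP; split; lra.
Qed.

Lemma continuous_mdist : continuous (fun z : T * T => mdist z.1 z.2).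
Proof.
move=> [x y]; apply/cvgrPdist_lt => e e0.
exists (ball x (e / 2), ball y (e / 2)).
  by split; apply: nbhsx_ballx; rewrite divr_gt0.
move=> [x' y'] /= []; rewrite !ballEmdist /= => xx' yy'.
by apply: le_lt_trans (mdist_lipschitz _ _ _ _) _; lra.
Qed.

End metric.

Lemma dense_sequence (T : topologicalType) : separable T -> [set: T] !=set0 ->
  exists s : nat -> T, dense (range s).
Proof.
move=> [S cS dS] T0; have [S0|S0] := eqVneq S set0.
  by move: (dS _ T0 openT); rewrite S0 setI0 => -[].
have /pfcard_geP[|[s]] := cS; first by move/eqP; rewrite (negbTE S0).
by exists s; rewrite image_eq.
Qed.

(** * Distance to the complement of the domain and near projections onto it *)

Section boundary_distance.
Context {R : realType} {X : metricType R} (Omega : domain X).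

Local Notation bdist := (dist_to (~` Omega)).

Lemma bdist_le (x y : X) : ~ (Omega : set X) y -> bdist x <= mdist x y.
Proof.
move=> Oy; apply: ge_inf; last by exists y.
by exists 0 => _ [z _ <-]; exact: mdist_ge0.
Qed.

Lemma bdist_lt_ex (x : X) (r : R) : bdist x < r ->
  exists2 y, ~ (Omega : set X) y & mdist x y < r.
Proof.
have O0 : ~` Omega !=set0.
  apply/set0P/eqP => CO0; move/eqP: (domain_proper Omega); apply.
  by rewrite -[LHS]setCK CO0 setC0.
move=> xr; have [|_ [y Oy <-] yr] := inf_lt _ xr; last by exists y.
by case: O0 => y Oy; exists (mdist x y), y.
Qed.

Lemma continuous_bdist : continuous (bdist : X -> R).
Proof.
move=> x; apply/cvgrPdist_lt => e e0.
apply/nbhs_ballP; exists e => // y; rewrite ballEmdist /=; apply: le_lt_trans.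
have := bdist_triangle Omega x y; have := bdist_triangle Omega y x.
rewrite (metric_sym y x) ler_norml => *; apply/andP; split; lra.
Qed.

(** When a term [s n] of a dense sequence is close to [x] relative to [bdist x], a near projection
    of [s n] serves for [x] as well, so one point per term suffices. *)
Lemma near_projections (c : R) : separable X -> 1 < c ->
  exists2 q : nat -> X, forall n, ~ (Omega : set X) (q n) &
    forall x, (Omega : set X) x -> exists n, mdist x (q n) < c * bdist x.
Proof.
move=> sX c1.
have [x0 _] := domain_neq0 Omega.
have [s ds] := dense_sequence _ sX (ex_intro _ x0 I).
(* Since h <= 1, (1 + h)^2 + h <= 1 + 4h <= c; the left side is the factor accumulated on the way
   from [x] through [s n] to [q n]. *)
pose h : R := Num.min 1 ((c - 1) / 4).
have h0 : 0 < h by rewrite /h lt_min; apply/andP; split; lra.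
have h1 : h <= 1 by rewrite /h ge_min lexx.
have hc : (1 + h) * (1 + h) + h <= c.
  have hc : h <= (c - 1) / 4 by rewrite /h ge_min lexx orbT.
  by nra.
(* The strict bound is unattainable when [bdist (s n)] is 0; [q n] is then an arbitrary point
   outside [Omega]. *)
have /choice[q qP] : forall n, exists y, ~ (Omega : set X) y /\
    (0 < bdist (s n) -> mdist (s n) y < (1 + h) * bdist (s n)).
  move=> n; have [b0|b0] := ltP 0 (bdist (s n)).
    have [|y Oy sy] := @bdist_lt_ex (s n) ((1 + h) * bdist (s n)).
      by nra.
    by exists y.
  have [|y Oy _] := @bdist_lt_ex x0 (bdist x0 + 1); first by rewrite ltrDl.
  by exists y; split=> //; rewrite ltNge b0.
exists q => [n|x Ox]; first by have [] := qP n.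
have b0 := bdist_gt0 Ox.
have bh0 : 0 < h * bdist x by rewrite mulr_gt0.
have [||y [xy [n _ sny]]] := ds (interior (ball x (h * bdist x))).
- by exists x; exact: nbhsx_ballx.
- exact: open_interior.
move: xy; rewrite -sny => /interior_subset; rewrite ballEmdist /= => xs.
exists n; have [_] := qP n.
have := bdist_triangle Omega x (s n); have := bdist_triangle Omega (s n) x.
(* The distance from [x] to [s n] is less than [h * bdist x <= bdist x], so [s n] is not at distance
   0 from the complement. *)
rewrite (metric_sym (s n) x) => sx xsx; have sn0 : 0 < bdist (s n).
  have : h * bdist x <= bdist x by rewrite ler_piMl// ltW.
  lra.
move=> /(_ sn0) sq; apply: le_lt_trans (metric_triangle _ (s n) _) _.
have : (1 + h) * bdist (s n) <= (1 + h) * ((1 + h) * bdist x).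
  by apply: ler_wpM2l; lra.
have : ((1 + h) * (1 + h) + h) * bdist x <= c * bdist x by rewrite ler_pM2r.
lra.
Qed.

End boundary_distance.

(** * Push-forwards, the infinite Dirac mass, superadditivity of powers *)

Section push.
Context {d d' : measure_display} {S : measurableType d} {T : measurableType d'}.
Context {R : realType} (m : {measure set S -> \bar R}) {f : S -> T}.
Hypothesis mf : measurable_fun [set: S] f.

Definition push : {measure set T -> \bar R}.
Proof. by refine (pushforward m f : {measure set T -> \bar R}); exact: mf. Defined.

Lemma pushE A : push A = m (f @^-1` A).
Proof. by []. Qed.

Lemma ge0_integral_push (g : T -> \bar R) :
  measurable_fun [set: T] g -> (forall x, 0 <= g x)%E ->
  (\int[push]_x g x = \int[m]_x g (f x))%E.
Proof.
by move=> mg g0; rewrite ge0_integral_pushforward ?preimage_setT// => x _.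
Qed.

End push.

Section infinite_dirac_integral.
Local Open Scope ereal_scope.
Context {d : measure_display} {T : measurableType d} {R : realType}.

(** The set where [f] is nonzero misses [a], hence is null. This makes infinite mass at a point of
    zero cost free. *)
Lemma ge0_integral_infinite_dirac (a : T) (f : T -> \bar R) :
  measurable_fun [set: T] f -> (forall x, 0 <= f x) -> f a = 0 ->
  \int[infinite_dirac a]_x f x = 0.
Proof.
move=> mf f0 fa; rewrite (ge0_ae_eq_integral (g := cst 0)) ?integral0//.
exists [set x | f x != 0]; split.
- by rewrite -[X in measurable X]setTI; exact: emeasurable_neq.
- by apply: (etrans (infinite_diracE a _)); rewrite memNset//= fa eqxx.
- by move=> x /= /not_implyP[_ /eqP].
Qed.

End infinite_dirac_integral.

Section power.
Context {R : realType}.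

(** With s = a + b, each x in {a, b} has x/s in [0, 1], so (x/s)^p <= x/s because p >= 1; multiply
    by s^p and add. *)
Lemma powR_superadditive (p a b : R) : 1 <= p -> 0 <= a -> 0 <= b ->
  a `^ p + b `^ p <= (a + b) `^ p.
Proof.
move=> p1 a0 b0; have [s0|s0] := eqVneq (a + b) 0.
  have [-> ->] : a = 0 /\ b = 0 by split; lra.
  by rewrite addr0 powR0 ?addr0//; apply: lt0r_neq0; lra.
have {}s0 : 0 < a + b by rewrite lt_neqAle eq_sym s0 addr_ge0.
have H x : 0 <= x <= a + b -> x `^ p <= x / (a + b) * (a + b) `^ p.
  move=> /andP[]; rewrite le_eqVlt => /predU1P[<- _|x0 xs].
    by rewrite powR0 ?mul0r//; apply: lt0r_neq0; lra.
  rewrite -{1}(@divfK _ (a + b) _ x) ?gt_eqF//; apply: ge1r_powRZ => //.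
    by rewrite divr_gt0//= ler_pdivrMr// mul1r.
  exact: ltW.
have := H a; have := H b; rewrite a0 b0 lerDl lerDr a0 b0 => /(_ isT) hb /(_ isT) ha.
apply: le_trans (lerD ha hb) _.
by rewrite -mulrDl -mulrDl divff ?mul1r// gt_eqF.
Qed.

End power.

(** * Collapsing the complement: [W <= Wb] *)

Section transport.
Local Open Scope ereal_scope.
Context {R : realType} {X : metricType R} {Omega : domain X}.
Variable p : R.

Local Notation bdist := (dist_to (~` Omega)).
Local Notation XX := (ambient Omega * ambient Omega)%type.
Local Notation SS := (shortcut Omega * shortcut Omega)%type.

Lemma cost_ge0 (T : metricType R) (z : T * T) : 0 <= cost p z.
Proof. by rewrite lee_fin powR_ge0. Qed.

Lemma measurable_ambient_cost :
  measurable_fun [set: borel XX] (cost p : borel XX -> \bar R).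
Proof.
apply/measurable_EFinP; apply: (measurableT_comp (measurable_powR p)).
apply: generated_measurable_fun_real; apply/continuousP.
exact: continuous_mdist.
Qed.

Lemma measurable_shortcut_cost :
  measurable_fun [set: borel SS] (cost p : borel SS -> \bar R).
Proof.
apply/measurable_EFinP; apply: (measurableT_comp (measurable_powR p)).
apply: generated_measurable_fun_real; apply/continuousP.
exact: continuous_mdist.
Qed.

Lemma mdist_shortcut (a b : shortcut Omega) : mdist a b = sdist a b.
Proof. by []. Qed.

Definition collapse (x : ambient Omega) : shortcut Omega :=
  insub (x : X).

Lemma collapse_val (x : set_type Omega) : collapse (set_val x) = Some x.
Proof. exact: valK. Qed.

(** Inside [Omega] the shortcut distance is a minimum involving [mdist]; if one point is outside, it
    is one of the competitors in the infimum [bdist]; if both are, they collapse to the same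
    point. *)
Lemma mdist_collapse (x y : ambient Omega) :
  (mdist (collapse x) (collapse y) <= mdist x y)%R.
Proof.
rewrite mdist_shortcut /collapse.
case: insubP => [u _ <-|/negP xO]; case: insubP => [v _ <-|/negP yO] /=.
- by rewrite ge_min lexx.
- by apply: bdist_le => /mem_set.
- by rewrite metric_sym; apply: bdist_le => /mem_set.
- exact: mdist_ge0.
Qed.

Definition collapse2 (z : XX) : SS := (collapse z.1, collapse z.2).

Lemma continuous_collapse : continuous collapse.
Proof.
move=> x; apply/cvg_ballP => e e0; apply/nbhs_ballP; exists e => // y.
by rewrite !ballEmdist /=; apply: le_lt_trans; exact: mdist_collapse.
Qed.

Lemma measurable_collapse2 :
  measurable_fun [set: borel XX] (collapse2 : borel XX -> borel SS).
Proof.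
apply: generated_measurable_fun => U oU; apply: sub_sigma_algebra.
move: U oU; apply/continuousP => z.
apply: (@continuous_at_pair _ _ _ (collapse \o fst) (collapse \o snd)).
  by apply: continuous_comp; [exact: cvg_fst|exact: continuous_collapse].
by apply: continuous_comp; [exact: cvg_snd|exact: continuous_collapse].
Qed.

Lemma addey_measure d (T : measurableType d) (m : {measure set T -> \bar R})
    (A : set T) : m A + +oo = +oo.
Proof. by rewrite addey// gt_eqF// (lt_le_trans (ltNyr 0)). Qed.

Lemma W_le_Wb (mu nu : borel_measure R (set_type Omega)) : (1 <= p)%R ->
  W p (iota' mu) (iota' nu) <= Wb p mu nu.
Proof.
(* A nonzero exponent is needed for zero distance to have zero cost, as 0 to the power 0 is 1. *)
move=> p1; have p0 : p != 0%R by apply: lt0r_neq0; lra.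
apply: le_ereal_inf_tmp => _ [gamma cg <-].
pose m1 : borel_measure R SS := push gamma measurable_collapse2.
(* Whatever mass [m1] carries over the additional point, adding [m2] makes both marginals infinite
   there. *)
pose m2 : borel_measure R SS := infinite_dirac ((None, None) : borel SS).
pose eta : borel_measure R SS := measure_add m1 m2.
(* Stated for a pair of matching projections [pr] and [qr], to treat both marginals at once. *)
have marginal (pr : SS -> shortcut Omega) (qr : XX -> ambient Omega)
    (lam : borel_measure R (set_type Omega)) :
    (forall z, pr (collapse2 z) = collapse (qr z)) -> pr (None, None) = None ->
    (forall B : set (borel (set_type Omega)), measurable B ->
      gamma (qr @^-1` (set_val @` B)) = lam B) ->
    forall B : set (borel (shortcut Omega)), measurable B ->
      eta (pr @^-1` B) = iota' lam B.
  move=> pq prN H B mB.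
  rewrite (_ : eta _ = m1 (pr @^-1` B) + m2 (pr @^-1` B)); last first.
    exact: measure_addE.
  rewrite iota'E [m2 _]infinite_diracE infinite_diracE.
  (* If [B] contains [None], both sides are infinite; otherwise the Dirac terms vanish and only
     points of [Omega] are collapsed into [B]. *)
  have [BN|BN] := pselect (B None).
    by rewrite mem_set ?mem_set// ?addey_measure// /preimage /= prN.
  rewrite memNset; last by rewrite /preimage /= prN.
  rewrite memNset// !adde0 -H.
    rewrite /m1 pushE; congr (gamma _); apply/seteqP; split => z /=.
      rewrite pq /collapse; case: insubP => // u _ uz Bu.
      by exists u.
    by move=> [u Bu uz]; rewrite pq -uz collapse_val.
  by rewrite -[X in measurable X]setTI; exact: measurable_shortcut_inj.
apply: (@le_trans _ _ ((\int[eta]_z cost p z) `^ p^-1)).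
  apply: ereal_inf_lbound; exists eta => // B mB; split.
    by apply: (marginal fst fst) => // C /cg[].
  by apply: (marginal snd snd) => // C /cg[].
apply: gt0_ler_poweR.
- by rewrite invr_ge0; lra.
- by rewrite in_itv /= leey andbT; apply: integral_ge0 => z _; exact: cost_ge0.
- by rewrite in_itv /= leey andbT; apply: integral_ge0 => z _; exact: cost_ge0.
rewrite ge0_integral_measure_add//; last 2 first.
- by move=> z _; exact: cost_ge0.
- exact: measurable_shortcut_cost.
rewrite ge0_integral_infinite_dirac//; last 3 first.
- exact: measurable_shortcut_cost.
- by move=> z; exact: cost_ge0.
- by rewrite /cost mdistxx powR0.
rewrite adde0 /m1 ge0_integral_push; last 2 first.
- exact: measurable_shortcut_cost.
- by move=> z; exact: cost_ge0.
apply: ge0_le_integral => //.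
- by move=> z _; exact: cost_ge0.
- apply: measurableT_comp measurable_collapse2; exact: measurable_shortcut_cost.
- exact: measurable_ambient_cost.
move=> z _; rewrite lee_fin; apply: ge0_ler_powR; rewrite ?nnegrE ?mdist_ge0//.
  by lra.
exact: mdist_collapse.
Qed.

End transport.

(** * Measurability by cases and open sets given by strict inequalities *)

Lemma measurable_fun_if_cst d (S : measurableType d) (T : pointedType)
    (G : set (set T)) (b : S -> bool) (g : S -> T) (y : T) :
  measurable [set z | b z] ->
  (forall U, G U -> measurable ([set z | b z] `&` g @^-1` U)) ->
  measurable_fun [set: S]
    (fun z => (if b z then g z else y) : g_sigma_algebraType G).
Proof.
move=> mb mg; apply: generated_measurable_fun => U GU.
(* Preimages under [g] occur only inside the set where [b] holds, so [g] may be irregular elsewhere,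
   as [lift] may be at [None]. *)
rewrite (_ : _ @^-1` U =
    ([set z | b z] `&` g @^-1` U) `|` (~` [set z | b z] `&` [set _ | U y])).
  apply: measurableU; first exact: mg.
  apply: measurableI; first exact: measurableC.
  by have [Uy|Uy] := pselect (U y); [rewrite (_ : [set _ | _] = setT)|
    rewrite (_ : [set _ | _] = set0)]; rewrite // predeqE.
apply/seteqP; split => z /=; have [bz|/negP bz] := boolP (b z).
- by left.
- by right.
- by move=> [[]|[]].
- by move=> [[]|[]].
Qed.

Lemma open_ltr (R : realType) (T : topologicalType) (f g : T -> R) :
  continuous f -> continuous g -> open [set x | f x < g x].
Proof.
move=> cf cg; rewrite (_ : [set x | _] = (g \- f) @^-1` [set r | 0 < r]).
  apply: open_comp; last exact: open_gt.
  by move=> x _; apply: cvgB; [exact: cg|exact: cf].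
by apply/seteqP; split => x /=; rewrite subr_gt0.
Qed.

(** * Lifting the shortcut space back to the ambient space *)

Section projection_coupling.
Local Open Scope ereal_scope.
Context {R : realType} {X : metricType R} (Omega : domain X).

Local Notation bdist := (dist_to (~` Omega)).
Local Notation XX := (ambient Omega * ambient Omega)%type.
Local Notation SS := (shortcut Omega * shortcut Omega)%type.

Variables (c : R) (q : nat -> X).

(* [q 0] is chosen outside Omega below, so that [lift] does not identify the
   additional point with a point of Omega. *)
Definition lift (a : shortcut Omega) : ambient Omega :=
  if a is Some x then set_val x else q 0.

(** The ball around [Some x] of radius [bdist x] misses [None], which lies at exactly that
    distance. *)
Lemma nbhs_shortcut_Some (a : shortcut Omega) :
  isSome a -> nbhs a [set b : shortcut Omega | isSome b].
Proof.
case: a => // x _; apply/nbhs_ballP; exists (bdist (set_val x)).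
  by apply: bdist_gt0; exact: set_valP.
by move=> [y|] //; rewrite ballEmdist /= mdist_shortcut /= ltxx.
Qed.

(** Closer than [bdist x] to [Some x], the boundary term of the minimum exceeds the distance, so the
    shortcut metric agrees with that of [X]. *)
Lemma lift_continuous_at (a : shortcut Omega) :
  isSome a -> {for a, continuous lift}.
Proof.
case: a => // x _.
have x0 : (0 < bdist (set_val x))%R by apply: bdist_gt0; exact: set_valP.
move=> U /nbhs_ballP[e /= e0 eU].
suff : nbhs (Some x : shortcut Omega) (lift @^-1` U) by [].
apply/nbhs_ballP; exists (Num.min e (bdist (set_val x))); first by rewrite /= lt_min e0.
move=> [y|]; rewrite ballEmdist /= mdist_shortcut /= lt_min.
  have y0 := bdist_ge0 Omega (set_val y); rewrite !gt_min => /andP[xe xb].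
  by apply: eU; rewrite ballEmdist /=; case/orP: xe; case/orP: xb; lra.
by rewrite ltxx andbF.
Qed.

(** The second entry is frozen at [q n] because the near projection takes that value on each piece
    of a countable partition. *)
Lemma open_lift_fst (n : nat) (U : set XX) : open U ->
  open [set z : SS | isSome z.1 /\ U (lift z.1, q n)].
Proof.
rewrite openE => oU; rewrite openE => z [z1 Uz].
have c1 : {for z, continuous (lift \o fst : SS -> _)}.
  by apply: continuous_comp; [exact: cvg_fst|exact: lift_continuous_at].
have c2 : {for z, continuous (fun _ : SS => q n : ambient Omega)}.
  exact: cvg_cst.
have zU : nbhs z [set w : SS | U (lift w.1, q n)].
  exact: continuous_at_pair _ _ _ _ _ _ c1 c2 _ (oU _ Uz).
have z1S : nbhs z [set w : SS | isSome w.1].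
  exact: (@cvg_fst _ _ _ _ _ _ (nbhs_shortcut_Some _ z1)).
by apply: (@filterS _ (nbhs z) _ _ _ _ (filterI z1S zU)) => w [].
Qed.

Lemma open_lift2 (U : set XX) : open U ->
  open [set z : SS | (isSome z.1 && isSome z.2) /\ U (lift z.1, lift z.2)].
Proof.
rewrite openE => oU; rewrite openE => z [/andP[z1 z2] Uz].
have c1 : {for z, continuous (lift \o fst : SS -> _)}.
  by apply: continuous_comp; [exact: cvg_fst|exact: lift_continuous_at].
have c2 : {for z, continuous (lift \o snd : SS -> _)}.
  by apply: continuous_comp; [exact: cvg_snd|exact: lift_continuous_at].
have zU : nbhs z [set w : SS | U (lift w.1, lift w.2)].
  exact: continuous_at_pair _ _ _ _ _ _ c1 c2 _ (oU _ Uz).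
have z1S : nbhs z [set w : SS | isSome w.1].
  exact: (@cvg_fst _ _ _ _ _ _ (nbhs_shortcut_Some _ z1)).
have z2S : nbhs z [set w : SS | isSome w.2].
  exact: (@cvg_snd _ _ _ _ _ _ (nbhs_shortcut_Some _ z2)).
apply: (@filterS _ (nbhs z) _ _ _ _ (filterI z1S (filterI z2S zU))) => w [w1 [w2 Uw]].
by split => //; apply/andP.
Qed.

(** * Measurable choice of a near projection *)

Definition nearby (n : nat) (a : shortcut Omega) : bool :=
  (mdist (lift a) (q n) < c * bdist (lift a))%R.

(** Choosing the least index gives measurable level sets. Under the hypotheses on [q] below, the
    default 0 is reached at [None] only. *)
Definition first_nearby (a : shortcut Omega) : nat :=
  if pselect (exists n, nearby n a) is left h then ex_minn h else 0.

Hypothesis q_out : forall n, ~ (Omega : set X) (q n).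
Hypothesis q_near :
  forall x, (Omega : set X) x -> exists n, (mdist x (q n) < c * bdist x)%R.

Lemma first_nearbyP (a : shortcut Omega) : isSome a ->
  nearby (first_nearby a) a /\
  forall m, nearby m a -> (first_nearby a <= m)%N.
Proof.
case: a => // x _; rewrite /first_nearby; case: pselect => [h|[]].
  by case: ex_minnP.
by apply: q_near; exact: set_valP.
Qed.

Definition proj (a : shortcut Omega) : ambient Omega := q (first_nearby a).

Lemma continuous_bdist_fst : continuous (bdist \o fst : XX -> R).
Proof.
by move=> w; apply: continuous_comp; [exact: cvg_fst|exact: continuous_bdist].
Qed.

Lemma continuous_bdist_snd : continuous (bdist \o snd : XX -> R).
Proof.
by move=> w; apply: continuous_comp; [exact: cvg_snd|exact: continuous_bdist].
Qed.

Lemma measurable_nearby (n : nat) :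
  measurable ([set z | isSome z.1 && nearby n z.1] : set (borel SS)).
Proof.
apply: sub_sigma_algebra.
rewrite (_ : [set z | _] = [set z : SS | isSome z.1 /\
    [set w : XX | (mdist w.1 w.2 < c * bdist w.1)%R] (lift z.1, q n)]).
  apply: open_lift_fst; apply: open_ltr => [|w]; first exact: continuous_mdist.
  apply: cvgM; first exact: cvg_cst.
  exact: continuous_bdist_fst.
by apply/seteqP; split => z /= /andP.
Qed.

(** The index is [n] where [q n] is near and no earlier [q m] is: a Boolean combination of finitely
    many measurable sets. *)
Lemma measurable_first_nearby (n : nat) :
  measurable ([set z | isSome z.1 /\ first_nearby z.1 = n] : set (borel SS)).
Proof.
pose V n : set (borel SS) := [set z | isSome z.1 && nearby n z.1].
rewrite (_ : [set z | _] = V n `\` \bigcup_(m in [set m | (m < n)%N]) V m).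
  apply: measurableD; first exact: measurable_nearby.
  by apply: bigcup_measurable => m _; exact: measurable_nearby.
apply/seteqP; split => z /=.
  move=> [z1 <-]; have [zn zmin] := first_nearbyP _ z1.
  split; first by rewrite /V /= z1.
  by move=> [m /= mn /andP[_ /zmin]]; rewrite leqNgt mn.
move=> [/andP[z1 zn] zmin]; split => //; have [fn fmin] := first_nearbyP _ z1.
apply/eqP; rewrite eqn_leq fmin//= leqNgt; apply/negP => lt.
by apply: zmin; exists (first_nearby z.1) => //; rewrite /V /= z1.
Qed.

(** * Direct pairs and the three transport maps *)

Definition direct (z : SS) : bool := isSome z.1 && isSome z.2 &&
  (mdist (lift z.1) (lift z.2) <= bdist (lift z.1) + bdist (lift z.2))%R.

(** The set is a difference of two open sets, since both the pairs avoiding [None] and those among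
    them with a strictly shorter boundary path form open sets. *)
Lemma measurable_direct : measurable ([set z | direct z] : set (borel SS)).
Proof.
rewrite (_ : [set z | _] = [set z : SS | (isSome z.1 && isSome z.2) /\
    [set: XX] (lift z.1, lift z.2)] `\` [set z : SS | (isSome z.1 && isSome z.2) /\
    [set w : XX | (bdist w.1 + bdist w.2 < mdist w.1 w.2)%R] (lift z.1, lift z.2)]).
  apply: measurableD; apply: sub_sigma_algebra; apply: open_lift2.
    exact: openT.
  apply: open_ltr => [w|]; last exact: continuous_mdist.
  by apply: cvgD; [exact: continuous_bdist_fst|exact: continuous_bdist_snd].
apply/seteqP; split => z /=; rewrite /direct leNgt.
  by move=> /andP[-> /negP h]; split => // -[].
by move=> [[-> _] h] /=; apply/negP => h'; apply: h.
Qed.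

(* In the three maps below, (q 0, q 0) absorbs the mass handled by the other maps:
   it lies outside Omega and has zero cost. *)
Definition keep (z : SS) : XX :=
  if direct z then (lift z.1, lift z.2) else (q 0, q 0).

Definition leave (z : SS) : XX :=
  if isSome z.1 && ~~ direct z then (lift z.1, proj z.1) else (q 0, q 0).

Definition enter (z : SS) : XX := swap_pair (leave (swap_pair z)).

Lemma measurable_keep :
  measurable_fun [set: borel SS] (keep : borel SS -> borel XX).
Proof.
apply: measurable_fun_if_cst => [|U oU]; first exact: measurable_direct.
rewrite (_ : _ `&` _ = [set z | direct z] `&`
    [set z : SS | (isSome z.1 && isSome z.2) /\ U (lift z.1, lift z.2)]).
  apply: measurableI; first exact: measurable_direct.
  by apply: sub_sigma_algebra; exact: open_lift2.
by apply/seteqP; split => z /= [dz]; [case/andP: (dz) => ->|case].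
Qed.

(** On each level set of [first_nearby] the projection is a constant [q n], and [lift] is continuous
    away from [None]; countably many pieces are glued. *)
Lemma measurable_leave :
  measurable_fun [set: borel SS] (leave : borel SS -> borel XX).
Proof.
pose D : set (borel SS) := [set z | isSome z.1 && ~~ direct z].
have mD : measurable D.
  rewrite (_ : D = [set z : SS | isSome z.1 /\ [set: XX] (lift z.1, q 0)] `\`
      [set z | direct z]).
    apply: measurableD measurable_direct; apply: sub_sigma_algebra.
    by apply: open_lift_fst; exact: openT.
  apply/seteqP; split => z; rewrite /D /=.
      by move=> /andP[-> /negP].
    by move=> [[-> _] /negP].
apply: measurable_fun_if_cst => // U oU.
rewrite (_ : _ `&` _ = D `&` \bigcup_n
    ([set z | isSome z.1 /\ first_nearby z.1 = n] `&`
     [set z : SS | isSome z.1 /\ U (lift z.1, q n)])).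
  apply: measurableI => //; apply: bigcup_measurable => n _; apply: measurableI.
    exact: measurable_first_nearby.
  by apply: sub_sigma_algebra; exact: open_lift_fst.
apply/seteqP; split => z /= [Dz].
  by move=> Uz; split => //; exists (first_nearby z.1); case/andP: Dz.
by move=> [n _ /= [[_ <-] [_ Uz]]].
Qed.

Lemma measurable_enter :
  measurable_fun [set: borel SS] (enter : borel SS -> borel XX).
Proof.
have mswap (S T : ptopologicalType) : measurable_fun [set: borel (S * T)%type]
    (swap_pair : borel (S * T)%type -> borel (T * S)%type).
  apply: generated_measurable_fun => U oU; apply: sub_sigma_algebra.
  by move: U oU; apply/continuousP; exact: swap_continuous.
apply: (measurableT_comp (mswap _ _)).
by apply: (measurableT_comp measurable_leave); exact: mswap.
Qed.

(** This symmetry transfers facts about [leave] to [enter]. *)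
Lemma direct_swap (z : SS) : direct (swap_pair z) = direct z.
Proof.
rewrite /direct /= [isSome z.2 && _]andbC metric_sym.
by rewrite [(bdist (lift z.2) + _)%R]addrC.
Qed.

(** * Cost of the three maps *)

Lemma mdist_leave (z : SS) : (mdist (leave z).1 (leave z).2 <=
  if isSome z.1 && ~~ direct z then c * bdist (lift z.1) else 0)%R.
Proof.
rewrite /leave; case: ifP => [/andP[z1 _]|_] /=; last by rewrite mdistxx.
by have [/ltW] := first_nearbyP _ z1.
Qed.

Lemma mdist_enter (z : SS) : (mdist (enter z).1 (enter z).2 <=
  if isSome z.2 && ~~ direct z then c * bdist (lift z.2) else 0)%R.
Proof.
by rewrite /enter /= metric_sym -direct_swap; exact: (mdist_leave (swap_pair z)).
Qed.

(** On a direct pair only [keep] costs anything, namely the shortcut cost. Otherwise [leave] and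
    [enter] cost at most the p-th powers of c times the two boundary distances, and superadditivity
    bounds their sum. *)
Lemma cost_split (p : R) (z : SS) : (1 <= p)%R -> (1 <= c)%R ->
  cost p (keep z) + (cost p (leave z) + cost p (enter z)) <=
  (c `^ p)%:E * cost p z.
Proof.
move=> p1 c1; have c0 : (0 <= c)%R by lra.
have p0 : (0 <= p)%R by lra.
have pn0 : p != 0%R by apply: lt0r_neq0; lra.
rewrite -!EFinD -EFinM lee_fin -powRM ?mdist_ge0//.
have mono (x y : R) : (0 <= x)%R -> (x <= y)%R -> (x `^ p <= y `^ p)%R.
  move=> x0 xy; apply: ge0_ler_powR; rewrite ?nnegrE//.
  exact: le_trans xy.
have := mono _ _ (mdist_ge0 _ _) (mdist_leave z).
have := mono _ _ (mdist_ge0 _ _) (mdist_enter z).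
rewrite /keep.
set L := (_ (leave z).1 _ `^ p)%R; set E := (_ (enter z).1 _ `^ p)%R.
have [dz|dz] := boolP (direct z); rewrite /= ?andbT ?andbF.
  rewrite powR0// => E0 L0.
  have -> : (mdist z.1 z.2 = mdist (lift z.1) (lift z.2))%R.
    move: dz; rewrite /direct mdist_shortcut; case: z.1 z.2 => [x|] [y|] //= h.
    exact/min_idPl.
  have := mono _ _ (mdist_ge0 (lift z.1) (lift z.2)) (ler_peMl (mdist_ge0 _ _) c1).
  move=> /=; lra.
rewrite mdistxx powR0// add0r => E1 L1.
apply: le_trans (lerD L1 E1) _.
apply: le_trans (powR_superadditive _ _ _ p1 _ _) _.
- by case: ifP => // _; rewrite mulr_ge0// bdist_ge0.
- by case: ifP => // _; rewrite mulr_ge0// bdist_ge0.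
apply: mono.
  by apply: addr_ge0; case: ifP => // _; rewrite mulr_ge0// bdist_ge0.
(* Off the direct pairs the shortcut distance is the sum of the boundary distances, with [None]
   contributing 0. *)
move: dz; rewrite /direct mdist_shortcut.
case: z.1 z.2 => [x|] [y|] //= dz; rewrite ?addr0 ?add0r ?mulr0//.
rewrite -mulrDr ler_wpM2l// le_min lexx andbT ltW// ltNge.
exact: dz.
Qed.

(** * Marginals and cost of the rerouted coupling *)

(** Allows a coupling to be tested on Borel subsets of [Omega]. The sets with Borel image form a
    sigma-algebra, because [Some] is injective with open range, and it contains the open sets by
    continuity of [lift]. *)
Lemma measurable_shortcut_image (B : set (borel (set_type Omega))) :
  measurable B -> measurable (shortcut_inj @` B).
Proof.
have: @measurable _ (borel (set_type Omega)) `<=`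
    [set B | measurable (shortcut_inj @` B)]; last exact.
move=> {B}; apply: smallest_sub; first split.
- by rewrite /= image_set0.
- move=> B /= mB; rewrite setTD (_ : _ @` _ =
      shortcut_inj @` setT `\` shortcut_inj @` B).
    apply: measurableD => //; apply: sub_sigma_algebra.
    rewrite openE => _ [x _ <-].
    have := nbhs_shortcut_Some (Some x) isT.
    by apply: filterS => -[y _|//]; exists y.
  apply/seteqP; split => [_ [x Bx <-]|_ [[x _ <-] h]].
    by split; [exists x|move=> [y By /Some_inj yx]; apply: Bx; rewrite -yx].
  by exists x => // Bx; apply: h; exists x.
- move=> F mF; rewrite /= image_bigcup; apply: bigcup_measurable => k _; exact: mF.
move=> _ [V oV <-] /=; apply: sub_sigma_algebra; rewrite openE => _ [x Vx <-].
have zV : nbhs (Some x : shortcut Omega) (lift @^-1` V).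
  apply: (@lift_continuous_at (Some x) isT V).
  exact: (open_nbhs_nbhs (conj oV Vx)).
apply: filterS (filterI (nbhs_shortcut_Some (Some x) isT) zV).
by move=> [y|] [] // _ Vy; exists y.
Qed.

Lemma lift_mem (B : set (set_type Omega)) (a : shortcut Omega) :
  (set_val @` B) (lift a) <-> (shortcut_inj @` B) a.
Proof.
split=> [[y By]|[y By <-]]; last by exists y.
case: a => [x|] /= yx; first by exists y => //; congr Some; exact: val_inj.
by exfalso; apply: (q_out 0); rewrite -yx; exact: set_valP.
Qed.

Lemma q_notin (B : set (set_type Omega)) (n : nat) : ~ (set_val @` B) (q n).
Proof. by move=> [y _ yq]; apply: (q_out n); rewrite -yq; exact: set_valP. Qed.

(** Together with [keep_fst_mem], splits the pairs starting in [B] into direct and non-direct ones;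
    the default value [(q 0, q 0)] never meets [Omega]. *)
Lemma leave_fst_mem (B : set (set_type Omega)) (z : SS) :
  (set_val @` B) (leave z).1 <-> (shortcut_inj @` B) z.1 /\ ~ direct z.
Proof.
rewrite /leave; case: ifP => [/andP[z1 /negP dz]|h] /=.
  by split => [/lift_mem|[/lift_mem]].
split => [/q_notin//|[[x Bx xz] /negP dz]].
by move: h; rewrite -xz dz.
Qed.

Lemma leave_snd_notin (B : set (set_type Omega)) (z : SS) :
  ~ (set_val @` B) (leave z).2.
Proof. by rewrite /leave; case: ifP => _ /=; exact: q_notin. Qed.

Lemma keep_fst_mem (B : set (set_type Omega)) (z : SS) :
  (set_val @` B) (keep z).1 <-> (shortcut_inj @` B) z.1 /\ direct z.
Proof.
rewrite /keep; case: ifP => dz /=; first by split => [/lift_mem|[/lift_mem]].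
by split => [/q_notin|[]].
Qed.

Lemma keep_snd_mem (B : set (set_type Omega)) (z : SS) :
  (set_val @` B) (keep z).2 <-> (shortcut_inj @` B) z.2 /\ direct z.
Proof.
rewrite /keep; case: ifP => dz /=; first by split => [/lift_mem|[/lift_mem]].
by split => [/q_notin|[]].
Qed.

Lemma measurable_shortcut_fst : measurable_fun [set: borel SS]
  (borel_fst : borel SS -> borel (shortcut Omega)).
Proof.
apply: generated_measurable_fun => U oU; apply: sub_sigma_algebra.
by move: U oU; apply/continuousP => z; exact: cvg_fst.
Qed.

Lemma measurable_shortcut_snd : measurable_fun [set: borel SS]
  (borel_snd : borel SS -> borel (shortcut Omega)).
Proof.
apply: generated_measurable_fun => U oU; apply: sub_sigma_algebra.
by move: U oU; apply/continuousP => z; exact: cvg_snd.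
Qed.

Lemma iota'_shortcut_image (lam : borel_measure R (set_type Omega))
    (B : set (borel (set_type Omega))) : iota' lam (shortcut_inj @` B) = lam B.
Proof.
rewrite iota'E infinite_diracE memNset ?adde0; last by move=> [].
congr (lam _); apply/seteqP; split => [x [y By /Some_inj <-]//|x Bx].
by exists x.
Qed.

(** The mass of a non-direct pair of points of [Omega] is used twice, once leaving and once
    entering; the surplus ends of both copies lie outside [Omega], where partial couplings are
    unconstrained. *)
Definition rerouted (gamma : borel_measure R SS) : borel_measure R XX :=
  measure_add (push gamma measurable_keep)
    (measure_add (push gamma measurable_leave) (push gamma measurable_enter)).

Lemma reroutedE gamma A : rerouted gamma A =
  gamma (keep @^-1` A) + (gamma (leave @^-1` A) + gamma (enter @^-1` A)).
Proof.
apply: (etrans (measure_addE _ _ _)); congr (_ + _).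
exact: (etrans (measure_addE _ _ _)).
Qed.

(** The image of [B] in the shortcut space misses the infinite atom, so [gamma] has the marginals
    [mu B] and [nu B] there. Over [Omega], the first marginal comes from [keep] and [leave], the
    second from [keep] and [enter]. *)
Lemma partial_coupling_rerouted mu nu gamma :
  coupling (iota' mu) (iota' nu) gamma ->
  partial_coupling mu nu (rerouted gamma).
Proof.
move=> cg B mB.
have mIB := measurable_shortcut_image _ mB.
have [gmu gnu] := cg _ mIB; rewrite !iota'_shortcut_image in gmu gnu.
rewrite -gmu -gnu /restr_domain /pushforward !reroutedE; split.
  (* [enter z] starts where [leave] of the swapped pair ends, that is outside [Omega]. *)
  rewrite (_ : enter @^-1` _ = set0); last first.
    by apply/seteqP; split => z // h; case: (leave_snd_notin _ _ h).
  rewrite measure0 adde0 [RHS](measureDI gamma _ measurable_direct); last first.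
    by rewrite -[X in measurable X]setTI; exact: measurable_shortcut_fst.
  rewrite addeC; congr (gamma _ + gamma _); apply/seteqP.
    by split => z /leave_fst_mem.
  by split => z /keep_fst_mem.
rewrite (_ : leave @^-1` _ = set0); last first.
  by apply/seteqP; split => z // h; case: (leave_snd_notin _ _ h).
rewrite measure0 add0e [RHS](measureDI gamma _ measurable_direct); last first.
  by rewrite -[X in measurable X]setTI; exact: measurable_shortcut_snd.
rewrite addeC; congr (gamma _ + gamma _); apply/seteqP.
  split => z.
    by move=> /(leave_fst_mem B (swap_pair z)); rewrite direct_swap.
  move=> [Bz dz]; apply/(leave_fst_mem B (swap_pair z)).
  by rewrite direct_swap.
by split => z /keep_snd_mem.
Qed.

Lemma rerouted_cost (p : R) (gamma : borel_measure R SS) :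
  (1 <= p)%R -> (1 <= c)%R ->
  \int[rerouted gamma]_z cost p z <= (c `^ p)%:E * \int[gamma]_z cost p z.
Proof.
move=> p1 c1.
have mA := @measurable_ambient_cost R X Omega p.
have mS := @measurable_shortcut_cost R X Omega p.
have mK : measurable_fun setT (fun z : borel SS => cost p (keep z) : \bar R).
  exact: (measurableT_comp mA measurable_keep).
have mL : measurable_fun setT (fun z : borel SS => cost p (leave z) : \bar R).
  exact: (measurableT_comp mA measurable_leave).
have mE : measurable_fun setT (fun z : borel SS => cost p (enter z) : \bar R).
  exact: (measurableT_comp mA measurable_enter).
have c0 (z : XX) : 0 <= cost p z by exact: cost_ge0.
have -> : \int[rerouted gamma]_z cost p z =
    \int[gamma]_z cost p (keep z) +
      (\int[gamma]_z cost p (leave z) + \int[gamma]_z cost p (enter z)).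
  rewrite -(ge0_integral_push gamma measurable_keep _ mA c0).
  rewrite -(ge0_integral_push gamma measurable_leave _ mA c0).
  rewrite -(ge0_integral_push gamma measurable_enter _ mA c0).
  rewrite -(ge0_integral_measure_add (push gamma measurable_leave)
    (push gamma measurable_enter) measurableT (fun z _ => c0 z) mA).
  exact: (ge0_integral_measure_add (push gamma measurable_keep)
    (measure_add (push gamma measurable_leave) (push gamma measurable_enter))
    measurableT (fun z _ => c0 z) mA).
rewrite -(ge0_integralD gamma measurableT (fun z _ => c0 (leave z)) mL
  (fun z _ => c0 (enter z)) mE).
have LE0 (z : borel SS) : setT z -> 0 <= cost p (leave z) + cost p (enter z).
  by move=> _; exact: adde_ge0.
rewrite -(ge0_integralD gamma measurableT (fun z _ => c0 (keep z)) mK LE0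
  (emeasurable_funD mL mE)).
have cS0 (z : borel SS) : setT z -> 0 <= cost p z by move=> _; exact: cost_ge0.
have cp0 : 0 <= (c `^ p)%:E by rewrite lee_fin powR_ge0.
rewrite -(ge0_integralZl gamma measurableT mS cS0 cp0).
apply: (ge0_le_integral gamma measurableT).
- by move=> z _; apply: adde_ge0 => //; exact: LE0.
- exact: (emeasurable_funD mK (emeasurable_funD mL mE)).
- exact: measurable_funeM.
- by move=> z _; exact: cost_split.
Qed.

End projection_coupling.

(** * The inequality [Wb <= W] and the isometry *)

Lemma Wb_le_W (R : realType) (X : metricType R) (Omega : domain X) (p : R)
    (mu nu : borel_measure R (set_type Omega)) :
  separable X -> 1 <= p -> (Wb p mu nu <= W p (iota' mu) (iota' nu))%E.
Proof.
move=> sX p1; apply: le_ereal_inf_tmp => _ [gamma cg <-].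
have p0 : p != 0 by apply: lt0r_neq0; lra.
set I := (\int[gamma]_z cost p z)%E.
have I0 : (0 <= I)%E by apply: integral_ge0 => z _; exact: cost_ge0.
have bound (c : R) : 1 < c -> (Wb p mu nu <= c%:E * I `^ p^-1)%E.
  move=> c1; have [q qO qN] := near_projections Omega c sX c1.
  have Wr : (Wb p mu nu <=
      (\int[rerouted Omega c q qN gamma]_z cost p z) `^ p^-1)%E.
    apply: ereal_inf_lbound; exists (rerouted Omega c q qN gamma) => //.
    exact: partial_coupling_rerouted.
  apply: (le_trans Wr).
  (* Writes [c] as a p-th root, to absorb it into the root of the cost bound. *)
  have -> : c%:E = ((c `^ p)%:E `^ p^-1)%E.
    by rewrite poweR_EFin -powRrM divff// powRr1//; lra.
  rewrite -poweRM ?lee_fin ?powR_ge0//; apply: gt0_ler_poweR.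
  - by rewrite invr_ge0; lra.
  - by rewrite in_itv /= leey andbT; apply: integral_ge0 => z _; exact: cost_ge0.
  - by rewrite in_itv /= leey andbT mule_ge0// lee_fin powR_ge0.
  by apply: rerouted_cost => //; exact: ltW.
have [->|J] := eqVneq (I `^ p^-1)%E +oo%E; first by rewrite leey.
have J0 : (0 <= I `^ p^-1)%E by exact: poweR_ge0.
move: J J0 bound; case: (I `^ p^-1)%E => [r| |]// _; rewrite lee_fin => r0 bound.
apply/lee_addgt0Pr => e e0.
(* With c = 1 + e/(r + 1) the bound c r is at most r + e; the added 1 keeps the divisor positive
   when r = 0. *)
have h0 : 0 < e / (r + 1) by rewrite divr_gt0//; lra.
apply: le_trans (bound (1 + e / (r + 1)) _) _; first by lra.
rewrite -EFinM -EFinD lee_fin mulrDl mul1r lerD2l mulrAC ler_pdivrMr; last lra.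
by rewrite ler_wpM2l; lra.
Qed.

Theorem lemma3p6 (R : realType) (X : metricType R) (X_separable : separable X)
    (Omega : domain X) (p : R) (p_ge1 : 1 <= p)
    (mu nu : borel_measure R (set_type Omega)) :
  Wb_space p mu -> Wb_space p nu ->
  W p (iota' mu) (iota' nu) = Wb p mu nu.
Proof.
by move=> _ _; apply/eqP; rewrite eq_le W_le_Wb//= Wb_le_W.
Qed.
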